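(* Let $\mathcal{H}$ be a finite-dimensional complex Hilbert space, $V\subset\mathcal{H}$ a subspace, $H$ a self-adjoint operator on $\mathcal{H}$, $U(t)=e^{-iHt}$, and let $\psi\in V$ with $\|\psi\|=1$. For $\eta\in(0,1]$ and integers $N\ge1$, let $\tau_N(\eta,t)$ be the expected first return time of $\psi$ to $V$ after at most $N$ weak measurements with coupling strength $\eta$. Then for $t=0$ and for all $\eta\in(0,1]$, $$\tau_N(\eta,0)=\frac1\eta-\frac{N(1-\eta)^N}{1-(1-\eta)^N}.$$ In particular, $\tau_\infty(\eta,0):=\lim_{N\to\infty}\tau_N(\eta,0)=\frac1\eta$. The rate at which $\tau_N(\eta,0)$ converges pointwise to $\frac1\eta$ is $c(\eta)=1-\eta$.
   Context: Let $P$ be the orthogonal projection of $\mathcal{H}$ onto $V$ and $Q=\mathbb{1}-P$. For $\eta\in(0,1]$ put $P_\eta=\sqrt{\eta}\,P$, $Q_\eta=Q+\sqrt{1-\eta}\,P$, $\tilde U_\eta(t)=Q_\eta U(t)$, and $\hat a_n^\eta(t)=P_\eta U(t)\tilde U_\eta(t)^{n-1}P$ for $n\ge1$. Define $p_n(\eta,t)=\|\hat a_n^\eta(t)\psi\|^2$, $R_N(\eta,t)=\sum_{n=1}^N p_n(\eta,t)$, and $\tau_N(\eta,t)=\frac{\sum_{n=1}^N n\,p_n(\eta,t)}{R_N(\eta,t)}$. The rate of convergence is defined by $$c(\eta):=\lim_{N\to\infty}\frac{|\tau_{N+1}(\eta,0)-\tau_\infty(\eta,0)|}{|\tau_N(\eta,0)-\tau_\infty(\eta,0)|}.$$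 *)

(* Defs.v *)
From HB Require Import structures.
From mathcomp Require Import all_boot all_order all_algebra.
From mathcomp Require Import complex.
From mathcomp Require Import all_classical all_reals all_analysis.

Set Implicit Arguments.
Unset Strict Implicit.
Unset Printing Implicit Defensive.

Import Order.TTheory GRing.Theory Num.Theory.
Import numFieldNormedType.Exports.

Local Open Scope classical_set_scope.
Local Open Scope ring_scope.
Local Open Scope complex_scope.

(* A finite-dimensional complex Hilbert space is a vectType T over R[i] with a
   positive definite Hermitian form dot, linear in its FIRST argument. *)

Section Hilbert.
Context (R : realType) (T : vectType R[i]) (dot : {dot T for @Num.conj R[i]}).

Definition hnorm (v : T) : R := Num.sqrt (complex.Re (dot v v)).

Definition selfadjoint (H : 'End(T)) : Prop :=
  forall u v : T, dot (H u) v = dot u (H v).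

Definition orthoproj (V : {vspace T}) : 'End(T) := daddv_pi V (orthov dot V).

Definition lfun_pow (A : 'End(T)) (n : nat) : 'End(T) :=
  iter n (comp_lfun A) \1%VF.

Definition exp_partial (A : 'End(T)) (N : nat) : 'End(T) :=
  \sum_(0 <= k < N) (k`!%:R)^-1 *: lfun_pow A k.

(* The sum of the exponential series.  Convergence is pointwise in the Hilbert
   norm, which in finite dimension is operator norm convergence; the limit
   always exists and is unique, so the default 0 is never used. *)
Definition lfun_exp (A : 'End(T)) : 'End(T) :=
  xget 0 [set E : 'End(T) |
    forall v, hnorm (exp_partial A N v - E v) @[N --> \oo] --> (0 : R)].

Definition evolution (H : 'End(T)) (t : R) : 'End(T) :=
  lfun_exp ((0 -i* t) *: H).

Section WeakMeasurement.
Context (V : {vspace T}) (H : 'End(T)) (psi : T) (eta t : R).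

Local Notation P := (orthoproj V).
Local Notation Q := (\1%VF - P).

Definition P_weak : 'End(T) := (Num.sqrt eta)%:C *: P.

Definition Q_weak : 'End(T) := Q + (Num.sqrt (1 - eta))%:C *: P.

Definition U_weak : 'End(T) := (Q_weak \o evolution H t)%VF.

(* The outcome operators are indexed by n >= 1; n = 0 is never used. *)
Definition return_op (n : nat) : 'End(T) :=
  (P_weak \o evolution H t \o lfun_pow U_weak n.-1 \o P)%VF.

Definition return_prob (n : nat) : R := hnorm (return_op n psi) ^+ 2.

Definition total_prob (N : nat) : R := \sum_(1 <= n < N.+1) return_prob n.

Definition return_time (N : nat) : R :=
  (\sum_(1 <= n < N.+1) n%:R * return_prob n) / total_prob N.

Definition return_time_oo : R := lim (return_time N @[N --> \oo]).

End WeakMeasurement.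

Section Rate.
Context (V : {vspace T}) (H : 'End(T)) (psi : T) (eta : R).

Local Notation tau := (return_time V H psi eta 0).
Local Notation tau_oo := (return_time_oo V H psi eta 0).

(* If eta = 1 then tau N = tau_oo for all N >= 1, so the quotient is 0 / 0;
   with the convention x / 0 = 0 the rate is then 0 = 1 - eta. *)
Definition rate_ratio (N : nat) : R :=
  `|tau N.+1 - tau_oo| / `|tau N - tau_oo|.

Definition convergence_rate : R := lim (rate_ratio N @[N --> \oo]).

End Rate.
End Hilbert.

(* Main.v *)
Require Import Defs.
From HB Require Import structures.
From mathcomp Require Import all_boot all_order all_algebra.
From mathcomp Require Import complex ring lra.
From mathcomp Require Import all_classical all_reals all_analysis.

Set Implicit Arguments.
Unset Strict Implicit.
Unset Printing Implicit Defensive.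

Import Order.TTheory GRing.Theory Num.Theory.
Import numFieldNormedType.Exports.

Local Open Scope classical_set_scope.
Local Open Scope ring_scope.
Local Open Scope complex_scope.

(* At t = 0 the evolution is the identity, and every psi in V is an eigenvector
   of Q_eta with eigenvalue sqrt(1 - eta).  The first return
   time is therefore geometric, p_n = eta (1 - eta)^(n-1), and the closed form
   of tau_N is that of the truncated mean of a geometric law.  With q = 1 - eta,
   the ratio of consecutive errors is ((N+1)/N) q (1 - q^N)/(1 - q^(N+1)). *)

Section Hilbert.
Context (R : realType) (T : vectType R[i]) (dot : {dot T for @Num.conj R[i]}).

(** Positive definiteness makes the real part of [dot v v] nonnegative, so squaring really undoes
    the square root. *)
Lemma hnorm_sqr v : hnorm dot v ^+ 2 = complex.Re (dot v v).
Proof.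
rewrite /hnorm sqr_sqrtr //.
have [->|/(neq0_dnorm_gt0 (s := dot))] := eqVneq v 0; first by rewrite linear0l.
by rewrite ltcE => /andP[_ /ltW].
Qed.

Lemma hnorm_sqrZ (a : R) v : hnorm dot (a%:C *: v) ^+ 2 = a ^+ 2 * hnorm dot v ^+ 2.
Proof.
rewrite !hnorm_sqr linearZl_LR linearZr_LR /= conj_Creal.
  by case: (dot v v) => x y /=; ring.
by rewrite complex_real.
Qed.

Lemma hnorm0_eq0 v : hnorm dot v = 0 -> v = 0.
Proof.
move=> /(congr1 (fun x => x ^+ 2)); rewrite hnorm_sqr expr0n /= => v0.
apply/eqP; apply: contra_eqT v0 => /(neq0_dnorm_gt0 (s := dot)).
by rewrite ltcE => /andP[_ /gt_eqF->].
Qed.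

Lemma hnorm0 : hnorm dot 0 = 0.
Proof. by rewrite /hnorm linear0l sqrtr0. Qed.

(** [daddv_pi] fixes [V] once [V] meets its orthogonal trivially. A vector [w] in both satisfies
    [dot w w = 0], hence vanishes by definiteness. *)
Lemma orthoproj_id (V : {vspace T}) v : v \in V -> orthoproj dot V v = v.
Proof.
apply: daddv_pi_id; apply/eqP; rewrite -subv0; apply/subvP => w.
rewrite memv_cap memv0 => /andP[wV /mem_orthovP/(_ w wV) ww0].
by apply: contra_eqT ww0 => /(neq0_dnorm_gt0 (s := dot)) /gt_eqF->.
Qed.

Lemma exp_partial0 N : exp_partial (0 : 'End(T)) N.+1 = \1%VF.
Proof.
rewrite /exp_partial big_nat_recl // fact0 invr1 scale1r big1 ?addr0 //.
by move=> k _; rewrite /lfun_pow iterS comp_lfun0l scaler0.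
Qed.

(** Since [xget] picks some limit, the identity must be shown to be the only one. The partial sums
    equal the identity from the first term on, so any limit [E] has [hnorm dot (v - E v) = 0] for
    all [v]. *)
Lemma lfun_exp0 : lfun_exp dot 0 = \1%VF.
Proof.
have cvg1 (E : 'End(T)) v : hnorm dot (exp_partial 0 N v - E v) @[N --> \oo]
    --> hnorm dot (v - E v).
  rewrite -(cvg_shiftS (fun N => hnorm dot (exp_partial 0 N v - E v))) /=.
  under eq_fun do rewrite exp_partial0 id_lfunE.
  exact: cvg_cst.
apply: xget_unique => [v|E cvgE].
  by have := cvg1 \1%VF v; rewrite id_lfunE subrr hnorm0.
apply/lfunP => v; rewrite id_lfunE; apply/esym/eqP; rewrite -subr_eq0.
apply/eqP/hnorm0_eq0; apply: (cvg_unique _ (cvg1 E v) (cvgE v)).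
exact: norm_hausdorff.
Qed.

Lemma evolution0 (H : 'End(T)) : evolution dot H 0 = \1%VF.
Proof. by rewrite /evolution oppr0 scale0r lfun_exp0. Qed.

Lemma lfun_pow_eigen (A : 'End(T)) a v n :
  A v = a *: v -> lfun_pow A n v = a ^+ n *: v.
Proof.
move=> Av; elim: n => [|n IHn]; first by rewrite id_lfunE expr0 scale1r.
by rewrite /lfun_pow iterS comp_lfunE /= IHn linearZ /= Av scalerA -exprSr.
Qed.

Lemma U_weak_zero (V : {vspace T}) (H : 'End(T)) eta v : v \in V ->
  U_weak dot V H eta 0 v = (Num.sqrt (1 - eta))%:C *: v.
Proof.
move=> vV; rewrite /U_weak evolution0 comp_lfun1r /Q_weak.
by rewrite !add_lfunE opp_lfunE scale_lfunE id_lfunE orthoproj_id // subrr add0r.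
Qed.

Lemma return_prob_zero (V : {vspace T}) (H : 'End(T)) psi eta n :
  psi \in V -> hnorm dot psi = 1 -> 0 <= eta <= 1 ->
  return_prob dot V H psi eta 0 n.+1 = eta * (1 - eta) ^+ n.
Proof.
move=> psiV psi1 /andP[eta0 eta1].
rewrite /return_prob /return_op evolution0 comp_lfun1r !comp_lfunE /=.
rewrite orthoproj_id // (lfun_pow_eigen _ (U_weak_zero H eta psiV)) linearZ /=.
rewrite /P_weak scale_lfunE orthoproj_id // scalerA -rmorphXn -rmorphM.
rewrite hnorm_sqrZ psi1 expr1n mulr1 exprMn -exprM mulnC exprM.
(* Both bounds on [eta] enter here: the radicands [eta] and [1 - eta] must be nonnegative. *)
by rewrite !sqr_sqrtr ?subr_ge0 // mulrC.
Qed.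

End Hilbert.

Lemma sum_geometric_prob (F : comPzRingType) (eta : F) N :
  \sum_(0 <= n < N) eta * (1 - eta) ^+ n = 1 - (1 - eta) ^+ N.
Proof.
elim: N => [|N IHN]; first by rewrite big_nil expr0 subrr.
by rewrite big_nat_recr //= IHN exprS; ring.
Qed.

(** This is the numerator of the truncated mean, split so that division by [1 - (1 - eta) ^+ N]
    gives the closed form at once. *)
Lemma sum_geometric_mean (F : fieldType) (eta : F) N : eta != 0 ->
  \sum_(0 <= n < N) n.+1%:R * (eta * (1 - eta) ^+ n) =
  (1 - (1 - eta) ^+ N) / eta - N%:R * (1 - eta) ^+ N.
Proof.
move=> eta0; elim: N => [|N IHN]; first by rewrite big_nil expr0 subrr mul0r mul0r subrr.
by rewrite big_nat_recr //= IHN exprS -natr1; field.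
Qed.

(** Adding [s ^+ N] to the left side gives a quantity that is nonincreasing in [N] and equals [1] at
    [N = 0]. For [s < 1] this bounds [N s ^ N] uniformly. *)
Lemma mulrn_expr_onem_le1 (F : realFieldType) (s : F) N : 0 <= s -> s <= 1 ->
  N%:R * s ^+ N * (1 - s) <= 1.
Proof.
move=> s0 s1; suff : N%:R * s ^+ N * (1 - s) + s ^+ N <= 1.
  by apply: le_trans; rewrite lerDl exprn_ge0.
elim: N => [|N]; first by rewrite !mul0r add0r.
apply: le_trans; rewrite -subr_ge0 exprS -natr1.
have -> : N%:R * s ^+ N * (1 - s) + s ^+ N
    - ((N%:R + 1) * (s * s ^+ N) * (1 - s) + s * s ^+ N)
  = s ^+ N * ((N%:R + 1) * (1 - s) ^+ 2) by ring.
by rewrite natr1 !mulr_ge0 ?exprn_ge0 ?subr_ge0 ?ler0n.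
Qed.

Section GeometricLimits.
Context (R : realType) (q : R) (q01 : 0 <= q < 1).

Lemma cvg_expr0 : q ^+ N @[N --> \oo] --> (0 : R).
Proof. by apply: cvg_expr; case/andP: q01 => q0 ?; rewrite ger0_norm. Qed.

(* With [s = sqrt q], [N q ^ N] is the product of the bounded [N s ^ N] and of
   [s ^ N], which tends to [0]. *)
Lemma cvg_natr_expr : N%:R * q ^+ N @[N --> \oo] --> (0 : R).
Proof.
have [q0 q1] := andP q01; pose s := Num.sqrt q.
have s0 : 0 <= s := sqrtr_ge0 q.
have s1 : s < 1 by rewrite -sqrtr1 ltr_sqrt.
have bound N : N%:R * s ^+ N <= (1 - s)^-1.
  rewrite -[_^-1]mul1r ler_pdivlMr ?subr_gt0 //.
  exact: mulrn_expr_onem_le1 (ltW s1).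
apply: (@squeeze_cvgr _ _ _ _ (cst 0) (fun N => (1 - s)^-1 * s ^+ N)).
- apply: nearW => N; rewrite mulr_ge0 ?exprn_ge0 //=.
  by rewrite -(sqr_sqrtr q0) -exprM mulnC exprM -/s expr2 mulrA ler_wpM2r ?exprn_ge0.
- exact: cvg_cst.
- rewrite -[X in _ --> X](mulr0 (1 - s)^-1); apply: cvgM; first exact: cvg_cst.
  by apply: cvg_expr; rewrite ger0_norm.
Qed.

Lemma cvg_onem_expr : 1 - q ^+ N @[N --> \oo] --> (1 : R).
Proof. by rewrite -[X in _ --> X]subr0; apply: cvgB cvg_expr0; exact: cvg_cst. Qed.

End GeometricLimits.

Theorem lemmaA9 (R : realType) (T : vectType R[i])
    (dot : {dot T for @Num.conj R[i]}) (V : {vspace T}) (H : 'End(T))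
    (psi : T) (eta : R) :
  selfadjoint dot H -> psi \in V -> hnorm dot psi = 1 -> 0 < eta <= 1 ->
  [/\ forall N : nat, (1 <= N)%N ->
        return_time dot V H psi eta 0 N =
          eta^-1 - N%:R * (1 - eta) ^+ N / (1 - (1 - eta) ^+ N),
      return_time dot V H psi eta 0 N @[N --> \oo] --> eta^-1,
      return_time_oo dot V H psi eta 0 = eta^-1,
      cvgn (rate_ratio dot V H psi eta) &
      convergence_rate dot V H psi eta = 1 - eta].
Proof.
move=> _ psiV psi1 /andP[eta0 eta1].
set q := 1 - eta.
have q01 : 0 <= q < 1 by rewrite /q; lra.
have eta_neq0 : eta != 0 by rewrite gt_eqF.
have qN N : 1 - q ^+ N.+1 != 0.
  by rewrite subr_eq0 eq_sym lt_eqF // exprn_ilt1 //; case/andP: q01.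
have tauE N : (1 <= N)%N ->
    return_time dot V H psi eta 0 N = eta^-1 - N%:R * q ^+ N / (1 - q ^+ N).
  case: N => // N _.
  have probE n : return_prob dot V H psi eta 0 n.+1 = eta * q ^+ n.
    by apply: return_prob_zero => //; rewrite ltW.
  rewrite /return_time /total_prob !big_add1 /=.
  under eq_bigr do rewrite probE.
  under [X in _ / X]eq_bigr do rewrite probE.
  rewrite sum_geometric_prob sum_geometric_mean // -/q mulrBl.
  by rewrite mulrAC divff ?mul1r.
have tau_cvg : return_time dot V H psi eta 0 N @[N --> \oo] --> eta^-1.
  (* The two sequences agree only from [N = 1] on: at [N = 0] the return time is [0 / 0 = 0]. *)
  suff : eta^-1 - N%:R * q ^+ N / (1 - q ^+ N) @[N --> \oo] --> eta^-1.
    apply: cvg_trans; apply: near_eq_cvg; near=> N.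
    by rewrite tauE //; near: N; exact: nbhs_infty_ge.
  rewrite -[X in _ --> X](subr0 eta^-1) -[X in _ - X](mul0r (1^-1)).
  apply: cvgB; first exact: cvg_cst.
  apply: cvgM; first exact: cvg_natr_expr.
  by apply: cvgV => //; exact: cvg_onem_expr.
have tau_oo : return_time_oo dot V H psi eta 0 = eta^-1 by exact/cvg_lim.
(* The index is shifted to stay in the range of the closed form, and [(N+2)/(N+1)] is written with a
   harmonic term, whose limit is known. *)
have ratioE N : rate_ratio dot V H psi eta N.+1 =
    (1 + N.+1%:R^-1) * q * ((1 - q ^+ N.+1) / (1 - q ^+ N.+2)).
  rewrite /rate_ratio tau_oo !tauE // !(addrC eta^-1) !addrK !normrN.
  case/andP: q01 => q0 q1.
  have ge0 n : 0 <= n%:R * q ^+ n / (1 - q ^+ n).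
    by rewrite divr_ge0 ?mulr_ge0 ?exprn_ge0 ?subr_ge0 ?exprn_ile1 // ltW.
  rewrite !ger0_norm //.
  (* For [q = 0], that is [eta = 1], both errors vanish; the quotient [0 / 0] is [0], which matches
     the factor [q] on the right. *)
  have [->|q_neq0] := eqVneq q 0.
    by rewrite !expr0n !mulr0 !mul0r.
  have := qN N; have := qN N.+1; rewrite exprS -(natr1 N.+1).
  move: (expf_neq0 N.+1 q_neq0); set x := q ^+ _ => x0 qx1 x1.
  by field; rewrite qx1 x1 x0 addrC natr1 pnatr_eq0.
have ratio_cvg : rate_ratio dot V H psi eta N @[N --> \oo] --> q.
  rewrite -(cvg_shiftS (rate_ratio dot V H psi eta)) /=.
  under eq_fun do rewrite ratioE.
  (* The limit is left unsimplified so that it matches the sequence factor by factor. *)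
  suff : (1 + N.+1%:R^-1) * q * ((1 - q ^+ N.+1) / (1 - q ^+ N.+2))
      @[N --> \oo] --> (1 + 0) * q * (1 / 1) by rewrite addr0 mul1r divr1 mulr1.
  have den := cvg_onem_expr q01.
  apply: cvgM; first apply: cvgM.
  - by apply: cvgD; [exact: cvg_cst | exact: cvg_harmonic].
  - exact: cvg_cst.
  apply: cvgM; first by rewrite (cvg_shiftS (fun N => 1 - q ^+ N)).
  apply: cvgV; first exact: oner_neq0.
  by rewrite (cvg_shiftS (fun N => 1 - q ^+ N.+1)) (cvg_shiftS (fun N => 1 - q ^+ N)).
split=> //; first by apply/cvg_ex; exists q.
exact/cvg_lim.
Unshelve. all: by end_near.
Qed.
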